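(* There is a crowded, $T_2$, zerodimensional topology $\tau$ on $\omega$ and a strongly remote filter on the space $(\omega,\tau)$.
   Context: A space is crowded if it has no isolated points, and zerodimensional if it has a base of clopen sets. A closed filter on a space $X$ is a (proper) filter in the lattice of closed subsets of $X$: a nonempty family of nonempty closed subsets of $X$ that is closed under finite intersections and under closed supersets. A closed filter $\mathcal{F}$ on $X$ is strongly remote if for any set $A\subseteq X$ with empty interior there is an $F\in\mathcal{F}$ which is disjoint from $A$. A strongly remote filter is a closed filter with this property. *)

(* Defs.v *)
From HB Require Import structures.
From mathcomp Require Import all_boot all_order.
From mathcomp Require Import all_classical topology.

Set Implicit Arguments.
Unset Strict Implicit.
Unset Printing Implicit Defensive.

Local Open Scope classical_set_scope.

(* A topology on the type T is a Topological structure on T, and space_of tau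
   is the space (T, tau).  Since nat carries a canonical (discrete) topology
   in the library, the structure is always packed explicitly. *)
Definition topology_on (T : Type) : Type := Topological.axioms_ T.

Definition space_of (T : Type) (tau : topology_on T) : topologicalType :=
  Topological.Pack tau.

Definition crowded (X : topologicalType) : Prop :=
  isolated [set: X] = set0.

(* The library's zero_dimensional only asks that distinct points be separated
   by a clopen set, which does not provide a base of clopen sets. *)
Definition zerodimensional (X : topologicalType) : Prop :=
  exists2 B : set (set X), basis B & B `<=` clopen.

Record closed_filter (X : topologicalType) (F : set_system X) : Prop := {
  closed_filter_nonempty : F !=set0 ;
  closed_filter_closed : F `<=` closed ;
  closed_filter_proper : ~ F set0 ;
  closed_filterI : setI_closed F ;
  closed_filterS : forall P Q : set X, P `<=` Q -> closed Q -> F P -> F Q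
}.

Definition strongly_remote (X : topologicalType) (F : set_system X) : Prop :=
  forall A : set X, interior A = set0 -> exists2 P, F P & [disjoint P & A].

Definition strongly_remote_filter (X : topologicalType) (F : set_system X)
    : Prop :=
  closed_filter F /\ strongly_remote F.

(* Main.v *)
Require Import Defs.
From HB Require Import structures.
From mathcomp Require Import all_boot all_order.
From mathcomp Require Import all_classical topology.

Set Implicit Arguments.
Unset Strict Implicit.
Unset Printing Implicit Defensive.

Local Open Scope classical_set_scope.

(** Start from an independent family of subsets A_E of nat that is indexed by
    the subsets E of nat themselves, so that every set E owns a coordinate.
    For a set S of subsets of nat, puncture the family along S: replace A_E by
    A_E minus E for each E in S, and keep A_E for the other E.  By Zorn's lemma
    there is a maximal S for which the punctured family is still independent
    (maximal_puncture).  Give nat the topology in which all members of the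
    punctured family are clopen.

    If E is not in S, then puncturing E as well would destroy independence, and
    the only way in which this can happen is that some nonempty basic clopen
    set lies inside E.  Hence every E with empty interior is in S, and its
    coordinate A_E minus E is a clopen set disjoint from E.  All these clopen
    sets have the finite intersection property because they belong to one
    independent family, so the closed sets that contain a finite intersection
    of members of the family form a strongly remote filter
    (family_filter_closed_filter).

    The space is zerodimensional by construction, and crowded because an
    infinite independent family splits every basic clopen set into two nonempty
    parts.  Singletons therefore have empty interior and are in S.  For the
    Hausdorff property, arrange in advance that the set indexed by [set y]
    contains all x < y (separated_nat): its punctured version still contains
    these x, but not y.  This costs only finitely many points in each set, which
    independence survives (independent_finite_change). *)

(** * Independent families *)

Section Independence.
Variables (I : choiceType) (T : eqType).
Implicit Types (A : I -> T -> bool) (P : seq I) (t : I -> bool).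

(** The target t is total and only the coordinates in P are prescribed, so that
    disjointness of the positive and the negative coordinates need not be
    stated. *)
Definition independent A : Prop :=
  forall t P, exists x, {in P, forall i, A i x = t i}.

Hypothesis infI : infinite_set [set: I].

Lemma infinite_notin_seq P : exists i, i \notin P.
Proof.
apply: contrapT => nex; apply: infI.
apply: (@sub_finite_set _ _ [set` P]); last exact: finite_seq.
by move=> i _ /=; apply: contrapT => /negP iP; apply: nex; exists i.
Qed.

(** Every nonempty Boolean combination is in fact infinite: a point k is avoided
    by prescribing one fresh coordinate opposite to the one of k. *)
Lemma independent_avoid A (K : seq T) t P : independent A ->
  exists2 x, x \notin K & {in P, forall i, A i x = t i}.
Proof.
move=> indA; elim: K t P => [|k K IH] t P.
  by have [x xP] := indA t P; exists x.
have [i iP] := infinite_notin_seq P.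
have [x xK xP] := IH (fun j => if j == i then ~~ A i k else t j) (i :: P).
exists x.
  rewrite in_cons negb_or xK andbT; apply: contraTneq (mem_head i P) => xk.
  by move: (xP i (mem_head i P)); rewrite eqxx xk; case: (A i k).
move=> j jP; rewrite xP ?in_cons ?jP ?orbT //.
by case: eqP iP => // <-; rewrite jP.
Qed.

(** A Boolean combination of the A_i has a point outside the finitely many
    points that were changed. *)
Lemma independent_finite_change A B :
  (forall i, exists K : seq T, forall x, x \notin K -> B i x = A i x) ->
  independent A -> independent B.
Proof.
move=> /choice[K AB] indA t P.
have [x xK xP] := independent_avoid (flatten (map K P)) t P indA.
exists x => i iP; rewrite AB ?xP //.
by apply: contra xK => xKi; apply/flatten_mapP; exists i.
Qed.

End Independence.

(** * A separating independent family on nat *)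

Definition restrict (D : seq nat) (E : set nat) : seq bool :=
  [seq n \in E | n <- D].

Lemma restrict_separates (P : seq (set nat)) :
  exists D, {in P &, injective (restrict D)}.
Proof.
have /choice[d dP] (EF : set nat * set nat) :
    exists n : nat, (n \in EF.1) = (n \in EF.2) -> EF.1 = EF.2.
  apply: contrapT => nex; apply: (nex); exists 0 => _.
  apply/seteqP; split=> n nE; apply: contrapT => nF; apply: nex; exists n.
    by rewrite mem_set // memNset.
  by rewrite memNset // mem_set.
exists [seq d (E, F) | E <- P, F <- P] => E F EP FP eqEF.
apply: (dP (E, F)); move/eq_in_map: eqEF; apply.
by apply/allpairsP; exists (E, F).
Qed.

(** The classical independent family of size continuum: a point codes a finite
    set D of positions and a list L of patterns on D, and it lies in the set of
    E when E has one of these patterns on D. *)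
Definition independent_nat (E : set nat) (x : nat) : bool :=
  if unpickle x is Some (D, L) then restrict D E \in (L : seq (seq bool))
  else false.

Lemma independent_nat_independent : independent independent_nat.
Proof.
move=> t P; have [D injD] := restrict_separates P.
exists (pickle (D, [seq restrict D E | E <- P & t E])) => E EP.
rewrite /independent_nat pickleK; apply/mapP/idP => [[F]|tE].
  by rewrite mem_filter => /andP[tF FP] /injD ->.
by exists E => //; rewrite mem_filter tE.
Qed.

Lemma infinite_set_nat : infinite_set [set: set nat].
Proof.
move=> finT; apply: infinite_nat.
rewrite -(preimage_setT (@set1 nat)); apply: finite_preimage finT.
by move=> x y _ _ /seteqP[/(_ x erefl)].
Qed.

(** The points added to the set of [set y] survive the removal of y from it, and
    this is what makes the final topology Hausdorff. *)
Definition separated_nat (E : set nat) (x : nat) : bool :=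
  independent_nat E x || `[< exists2 y, E = [set y] & (x < y)%N >].

Lemma separated_nat_independent : independent separated_nat.
Proof.
apply: (independent_finite_change infinite_set_nat) independent_nat_independent.
move=> E; have [[y ->]|nE] := pselect (exists y, E = [set y]).
  exists (iota 0 y) => x; rewrite mem_iota add0n /= => xy.
  rewrite /separated_nat asboolF ?orbF // => -[z /seteqP[/(_ y erefl) /= <- _]].
  exact/negP.
exists [::] => x _; rewrite /separated_nat asboolF ?orbF //.
by case=> y Ey _; apply: nE; exists y.
Qed.

Lemma separated_nat_lt x y : (x < y)%N -> separated_nat [set y] x.
Proof. by move=> xy; apply/orP; right; apply/asboolP; exists y. Qed.

(** * The topology generated by a family of clopen sets *)

(** The family is a phantom argument: it selects the topology on T. *)
Definition family_space (I T : Type) (A : I -> T -> bool) : Type := T.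

Section FamilySpace.
Variables (I : choiceType) (T : choiceType) (A : I -> T -> bool).
Implicit Types (P : seq I) (x : T) (U : set T).

(** The nonempty Boolean combinations of the family, each named by one of its
    points; they form the base. *)
Definition cell P x : set T := [set y | {in P, forall i, A i y = A i x}].

Lemma cell_cat P Q x : cell (P ++ Q) x = cell P x `&` cell Q x.
Proof.
apply/seteqP; split=> y /=.
  by move=> yPQ; split=> i iP; apply: yPQ; rewrite mem_cat iP ?orbT.
by case=> yP yQ i; rewrite mem_cat => /orP[/yP|/yQ].
Qed.

Lemma cell_eq P x y : cell P x y -> cell P y = cell P x.
Proof.
move=> xy; apply/seteqP; split=> z /= yz i iP; rewrite yz //.
  by rewrite xy.
by rewrite -xy.
Qed.

Definition family_open U : Prop :=
  forall x, U x -> exists P, cell P x `<=` U.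

Lemma family_openT : family_open setT.
Proof. by move=> x _; exists [::]. Qed.

Lemma family_openI : setI_closed family_open.
Proof.
move=> U V oU oV x [/oU[P PU] /oV[Q QV]].
by exists (P ++ Q); rewrite cell_cat; apply: setISS.
Qed.

Lemma family_open_bigcup (J : Type) (f : J -> set T) :
  (forall j, family_open (f j)) -> family_open (\bigcup_j f j).
Proof.
move=> of_ x [j _ /of_[P Pf]]; exists P => y /Pf fy; by exists j.
Qed.

Local Notation X := (family_space A).

HB.instance Definition _ := Choice.on X.
HB.instance Definition _ := isOpenTopological.Build X
  family_openT family_openI family_open_bigcup.

Lemma family_openP (U : set X) : open U <-> family_open U.
Proof. by []. Qed.

Lemma open_cell P x : open (cell P x : set X).
Proof. by apply/family_openP => y /cell_eq <-; exists P. Qed.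

Lemma nbhsP x (U : set X) :
  nbhs (x : X) U <-> exists P, cell P x `<=` U.
Proof.
split=> [|[P PU]]; rewrite nbhsE /=.
  by case=> V [/family_openP oV /oV[P PV] VU]; exists P; apply: subset_trans VU.
by exists (cell P x) => //; split=> //; apply: open_cell.
Qed.

Lemma clopen_cell P x : clopen (cell P x : set X).
Proof.
split; first exact: open_cell.
rewrite -openC; apply/family_openP => y nxy; exists P => z yz xz; apply: nxy.
by rewrite -(cell_eq xz) (cell_eq yz).
Qed.

Lemma clopen_family i : clopen ([set x | A i x] : set X).
Proof.
split; last rewrite -openC; apply/family_openP => x xi; exists [:: i] => y /= yx.
  by rewrite yx // mem_head.
by rewrite yx // mem_head.
Qed.

Lemma family_space_zerodimensional : zerodimensional X.
Proof.
exists [set U : set X | exists P x, U = cell P x]; last first.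
  by move=> _ [P [x ->]]; apply: clopen_cell.
split=> [_ [P [x ->]]|x U /nbhsP[P PU]]; first exact: open_cell.
by exists (cell P x) => //; split=> //; exists P, x.
Qed.

Lemma family_space_hausdorff :
  (forall x y, x != y -> exists i, A i x != A i y) ->
  hausdorff_space X.
Proof.
move=> sep x y xy; apply/eqP; apply: contraT => /sep[i ixy].
have cellN z : nbhs (z : X) (cell [:: i] z).
  by apply/nbhsP; exists [:: i].
have [z [zx zy]] := xy _ _ (cellN x) (cellN y).
by move: ixy; rewrite -(zx i) ?mem_head // -(zy i) ?mem_head // eqxx.
Qed.

Lemma cell_not_singleton P x : infinite_set [set: I] -> independent A ->
  ~ cell P x `<=` [set x].
Proof.
move=> infI indA sP.
have [y] := independent_avoid infI [:: x] (A^~ x) P indA.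
by rewrite inE => /eqP yx /sP.
Qed.

Lemma family_space_crowded : infinite_set [set: I] -> independent A ->
  crowded X.
Proof.
move=> infI indA; rewrite /crowded -subset0 => x [_ [V /nbhsP[P PV]]].
rewrite setIT => Vx; apply: (@cell_not_singleton P x) => //.
by rewrite -Vx.
Qed.

Definition family_filter : set_system X :=
  [set U : set X | closed U /\ exists P, [set x | all (A^~ x) P] `<=` U].

Lemma family_filter_closed_filter : independent A ->
  closed_filter family_filter.
Proof.
move=> indA; split.
- by exists setT; split; [exact: closedT | exists [::]].
- by move=> ? [].
- move=> [_ [P P0]]; have [x xP] := indA xpredT P.
  by apply: (P0 x); apply/allP.
- move=> U V [cU [P PU]] [cV [Q QV]]; split; first exact: closedI.
  exists (P ++ Q) => x /=; rewrite all_cat => /andP[xP xQ].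
  by split; [apply: PU | apply: QV].
- move=> U V UV cV [_ [P PU]]; split=> //; exists P.
  exact: subset_trans UV.
Qed.

Lemma family_filter_mem i : family_filter [set x | A i x].
Proof.
split; first by case: (clopen_family i).
by exists [:: i] => x /=; rewrite andbT.
Qed.

End FamilySpace.

(** * Puncturing an independent family along its own indices *)

Section Puncture.
Variables (T : choiceType) (A : set T -> T -> bool).
Implicit Types (S : set (set T)) (E : set T).

Definition puncture S E x : bool := A E x && ~~ ((E \in S) && (x \in E)).

Lemma punctureE S S' E x : (S E <-> S' E) -> puncture S E x = puncture S' E x.
Proof.
move=> SS'; rewrite /puncture; congr (_ && ~~ (_ && _)).
by apply/idP/idP => /set_mem/SS'/mem_set.
Qed.

(** Puncturing E affects only the coordinate E, and that one loses only points
    of E. *)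
Lemma puncture_add S E F x : ~ E x ->
  puncture (S `|` [set E]) F x = puncture S F x.
Proof.
move=> nEx; have [->|FE] := eqVneq F E.
  by rewrite /puncture (memNset nEx) !andbF.
by apply: punctureE; split=> [[|/eqP/negPn/negP]|]; [|rewrite FE|left].
Qed.

Lemma puncture_sub S E x : E \in S -> x \in E -> ~~ puncture S E x.
Proof. by move=> ES xE; rewrite /puncture ES xE andbF. Qed.

(** A Boolean combination involves finitely many coordinates, and on these the
    union of a nonempty chain agrees with one of its members. *)
Lemma independent_bigcup_chain (C : set (set (set T))) :
  independent A ->
  (forall S, C S -> independent (puncture S)) ->
  total_on C subset -> independent (puncture (\bigcup_(S in C) S)).
Proof.
move=> indA indC totC t P; set U := \bigcup_(S in C) S.
have [S [indS SU US]] : exists S, [/\ independent (puncture S), S `<=` U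
    & forall E, E \in P -> U E -> S E].
  (* set0 stands in for a member of C when C is empty. *)
  suff [S [CS SU US]] : exists S, [/\ C S \/ S = set0, S `<=` U
      & forall E, E \in P -> U E -> S E].
    exists S; split=> //; case: CS => [/indC//|->].
    suff -> : puncture set0 = A by [].
    by apply/funext => E; apply/funext => x; rewrite /puncture in_set0 andbT.
  elim: P => [|E P [S [CS SU PS]]]; first by exists set0; split=> //; right.
  have [[S' CS' S'E]|nUE] := pselect (U E); last first.
    exists S; split=> // F; rewrite in_cons => /predU1P[-> //|]; exact: PS.
  have S'U : S' `<=` U by move=> F; exists S'.
  have [SS'|S'S] : S `<=` S' \/ S' `<=` S.
    by case: CS => [CS|->]; [exact: totC | left].
    exists S'; split=> //; first by left.
    by move=> F; rewrite in_cons => /predU1P[-> //|FP /(PS _ FP)/SS'].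
  exists S; split=> // F; rewrite in_cons => /predU1P[-> _|]; last exact: PS.
  exact: S'S.
have [x xP] := indS t P; exists x => E EP; rewrite -xP //.
by apply: punctureE; split=> [/(US _ EP)|/SU].
Qed.

(** If E is outside a maximal S, some combination (t, P) becomes unrealizable
    when E is punctured too.  The cell on which the family punctured along S
    realizes (t, P) must then lie inside E, since points outside E do not notice
    the additional puncture. *)
Lemma maximal_puncture : independent A ->
  exists2 S, independent (puncture S) &
    forall E, ~ S E -> exists P x, cell (puncture S) P x `<=` E.
Proof.
move=> indA.
have [|S [indS maxS]] := @Zorn_bigcup _ [set S | independent (puncture S)].
  by move=> C sC totC; apply: independent_bigcup_chain.
exists S => // E nSE.
have /maxS : S `<` S `|` [set E].
  split; first exact: subsetUl.
  by move=> /(_ E) SE; apply: nSE; apply: SE; right.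
move=> /existsNP[t /existsNP[P noP]].
have [x xP] := indS t P.
exists P, x => y xy; apply: contrapT => nEy; apply: noP; exists y => F FP.
by rewrite puncture_add // xy ?xP.
Qed.

End Puncture.

(** * The strongly remote filter *)

Theorem theorem5p2 :
  exists tau : topology_on nat,
    [/\ crowded (space_of tau),
        hausdorff_space (space_of tau),
        zerodimensional (space_of tau)
      & exists F : set_system (space_of tau), strongly_remote_filter F].
Proof.
have [S indS maxS] := maximal_puncture separated_nat_independent.
set A := puncture separated_nat S in indS maxS.
have S_of_int0 (E : set (family_space A)) : interior E = set0 -> S E.
  move=> E0; apply: contrapT => /maxS[P [x PE]].
  suff: interior E x by rewrite E0.
  by apply/nbhsP; exists P.
have A_off (E : set nat) x : S E -> E x -> A E x = false.
  move=> SE Ex; apply/negbTE.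
  by apply: puncture_sub; apply/mem_set.
exists (Topological.class (family_space A)); split.
- exact: (family_space_crowded infinite_set_nat indS).
- apply: (@family_space_hausdorff _ _ A).
  suff lt_sep x y : (x < y)%N -> A [set y] x != A [set y] y.
    move=> x y; rewrite neq_ltn => /orP[/lt_sep xy|/lt_sep yx].
      by exists [set y].
    by exists [set x]; rewrite eq_sym.
  move=> xy.
  have Sy : S [set y].
    apply: S_of_int0; rewrite -subset0 => z /nbhsP[P zP].
    apply: (@cell_not_singleton _ _ A P z infinite_set_nat indS).
    have zy : z = y by apply: zP.
    by rewrite [X in _ `<=` [set X]]zy.
  have -> : A [set y] x.
    rewrite /A /puncture separated_nat_lt // (@memNset _ [set y]) ?andbF //=.
    by move=> eq_xy; rewrite eq_xy ltnn in xy.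
  by rewrite A_off.
- exact: family_space_zerodimensional.
- exists (@family_filter _ _ A); split; first exact: family_filter_closed_filter.
  move=> E /S_of_int0 SE; exists [set x | A E x]; first exact: family_filter_mem.
  apply/disj_setPS => x [/= AEx Ex].
  by rewrite A_off in AEx.
Qed.
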